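(* Let $p\in[1,\infty)$. Assume that $Y\cap\mathbb{Z}^m$ is finite, that $\mu_Z$ has a uniformly bounded Lebesgue density, and that the support of $\mu_Z$ is compact. Then the following hold for any mapping $\mathcal{R}:\mathcal{L}^p(\Omega,\mathcal{F},\mathbb{P})\to\mathbb{R}$ and the function $\mathcal{Q}_{\mathcal{R}}:F_Z\to\mathbb{R}$, $\mathcal{Q}_{\mathcal{R}}(x):=\mathcal{R}[\mathbb{F}(x)]$: 1. $\mathcal{Q}_{\mathcal{R}}$ is locally Hölder continuous with exponent $\frac1p$ if $\mathcal{R}$ is convex and continuous. 2. $\mathcal{Q}_{\mathcal{R}}$ is locally Hölder continuous with exponent $\frac1p$ if $\mathcal{R}$ is convex and nondecreasing. 3. $\mathcal{Q}_{\mathcal{R}}$ is locally Hölder continuous with exponent $\frac1p$ if $\mathcal{R}$ is a convex risk measure. 4. $\mathcal{Q}_{\mathcal{R}}$ is Hölder continuous with exponent $\frac1p$ if $\mathcal{R}$ is Lipschitz continuous. 5. $\mathcal{Q}_{\mathcal{R}}$ is Hölder continuous with exponent $\frac1p$ if $\mathcal{R}$ is a coherent risk measure.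
   Context: Let $T\in\mathbb{R}^{s\times n}$, $W\in\mathbb{R}^{s\times m}$, $q,d\in\mathbb{R}^m$, and $Y\subseteq\mathbb{R}^m$ with $Y\cap\mathbb{Z}^m\neq\emptyset$. For $t\in\mathbb{R}^s$ let $\Psi(t):=\operatorname{Argmin}_y\{d^\top y \mid Wy\le t,\ y\in Y\cap\mathbb{Z}^m\}$ (the set of minimizers; inequalities are componentwise) and $\varphi(t):=\inf_y\{q^\top y\mid y\in\Psi(t)\}\in\mathbb{R}\cup\{\pm\infty\}$, with $\inf\emptyset=+\infty$; $\operatorname{dom}\varphi$ is the set of $t$ where $\varphi(t)$ is finite. Let $Z:\Omega\to\mathbb{R}^s$ be a random vector on a probability space $(\Omega,\mathcal{F},\mathbb{P})$, $\mu_Z:=\mathbb{P}\circ Z^{-1}$ its distribution, $F_Z:=\{x\in\mathbb{R}^n\mid Tx+z\in\operatorname{dom}\varphi\ \ \forall z\in\operatorname{supp}\mu_Z\}$. For $x\in F_Z$ put $\mathbb{F}(x)(\omega):=\varphi(Tx+Z(\omega))$; when $Y\cap\mathbb{Z}^m$ is finite this is an element of $\mathcal{L}^\infty(\Omega,\mathcal{F},\mathbb{P})\subseteq\mathcal{L}^p(\Omega,\mathcal{F},\mathbb{P})$. $\mathcal{R}$ is nondecreasing if $\mathcal{R}[Y_1]\le\mathcal{R}[Y_2]$ whenever $Y_1\le Y_2$ $\mathbb{P}$-almost surely; translation equivariant if $\mathcal{R}[Y+a]=\mathcal{R}[Y]+a$ for all $Y$ and $a\in\mathbb{R}$. A convex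 risk measure is a convex, nondecreasing, translation equivariant mapping; a coherent risk measure is a convex risk measure that is moreover positively homogeneous ($\mathcal{R}[\lambda Y]=\lambda\mathcal{R}[Y]$ for $\lambda\ge0$). Hölder continuity of $g:F_Z\to\mathbb{R}$ with exponent $\frac1p$ means that there is $L\ge 0$ with $|g(x)-g(x')|\le L\|x-x'\|^{1/p}$ for all $x,x'\in F_Z$; local Hölder continuity means that each point of $F_Z$ has a neighborhood in $F_Z$ on which such an estimate holds. *)

(* Defs.v *)
From HB Require Import structures.
From mathcomp Require Import all_boot all_order all_algebra.
From mathcomp Require Import all_classical all_reals all_analysis.
From mathcomp Require Import measurable_realfun.
Set Implicit Arguments.
Unset Strict Implicit.
Unset Printing Implicit Defensive.
Import Order.TTheory GRing.Theory Num.Theory.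
Import numFieldNormedType.Exports.
Local Open Scope classical_set_scope.
Local Open Scope ring_scope.

(* The product sigma-algebra on R^n, as the library does for n.-tuple; it is
   the Borel sigma-algebra by measurable_cVE below. *)
Section measurable_cV.
Context (R : realType) (n : nat).

Let coor (i : 'I_n) (v : 'cV[R]_n) : measurableTypeR R := v i ord0.

Let cV_set0 : g_sigma_preimage coor set0.
Proof. exact: sigma_algebra0. Qed.

Let cV_setC A : g_sigma_preimage coor A -> g_sigma_preimage coor (~` A).
Proof. exact: sigma_algebraC. Qed.

Let cV_bigcup (F : (set _)^nat) : (forall i, g_sigma_preimage coor (F i)) ->
  g_sigma_preimage coor (\bigcup_i (F i)).
Proof. exact: sigma_algebra_bigcup. Qed.

HB.instance Definition _ := @isMeasurable.Build default_measure_display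
  'cV[R]_n (g_sigma_preimage coor) cV_set0 cV_setC cV_bigcup.

End measurable_cV.

Section measurable_cV_theory.
Context (R : realType).

Lemma measurable_coord n (i : 'I_n) :
  measurable_fun [set: 'cV[R]_n] (fun v => v i ord0 : measurableTypeR R).
Proof.
move=> _ A mA; rewrite setTI; apply: sub_sigma_algebra => /=.
rewrite -bigcup_seq/=; exists i => /=; first by rewrite mem_index_enum.
by exists A => //; rewrite setTI.
Qed.

Lemma measurable_fun_cVP d (T : measurableType d) n (f : T -> 'cV[R]_n) :
  measurable_fun setT f <->
  forall i, measurable_fun setT (fun w => f w i ord0 : measurableTypeR R).
Proof.
split=> [mf i|mf].
  exact: (measurableT_comp (measurable_coord i) mf).
pose G := \big[setU/set0]_(i < n) preimage_set_system setT
    (fun v : 'cV[R]_n => v i ord0 : measurableTypeR R) measurable.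
apply: (@measurability _ _ _ _ _ _ G erefl) => _ [B + <-].
rewrite /G -bigcup_seq => -[i _ [A mA <-]].
rewrite !setTI.
by have := mf i measurableT A mA; rewrite setTI.
Qed.

Lemma measurable_ball_cV n (x : 'cV[R]_n) (r : R) : measurable (ball x r).
Proof.
case: (ltP 0 r) => r0; last first.
  rewrite (_ : ball x r = set0) ?measurable0//; apply/seteqP; split=> // y [].
  by rewrite ltNge r0.
rewrite (_ : ball x r = \bigcap_(i in [set: 'I_n])
    ((fun v : 'cV[R]_n => v i ord0 : measurableTypeR R) @^-1` ball (x i ord0) r)).
  apply: fin_bigcap_measurable => // i _.
  rewrite -[X in measurable X]setTI; apply: measurable_coord => //.
  by rewrite ball_itv; exact: measurable_itv.
apply/seteqP; split=> y.
  by move=> [_ xy] i _; exact: xy.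
move=> xy; split => // i j; rewrite ord1; exact: xy.
Qed.

Lemma open_measurable_cV n (U : set 'cV[R]_n) : open U -> measurable U.
Proof.
move=> oU.
pose I := ('cV[rat]_n * nat)%type.
pose c (q : I) : 'cV[R]_n := map_mx ratr q.1.
pose B (q : I) : set 'cV[R]_n :=
  if `[< ball (c q) q.2.+1%:R^-1 `<=` U >] then ball (c q) q.2.+1%:R^-1 else set0.
rewrite (_ : U = \bigcup_q B q).
  apply: countable_bigcupT_measurable => [|q]; first exact: countableP.
  rewrite /B.
  by case: ifPn => _; [exact: measurable_ball_cV|exact: measurable0].
apply/seteqP; split=> [x Ux|x [q _]]; last first.
  by rewrite /B; case: asboolP => // + ?; exact.
have /nbhs_ballP[e /= e0 xeU] : nbhs x U by exact: open_nbhs_nbhs.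
pose k := Num.truncn (e^-1 * 2).
have ke : k.+1%:R^-1 + k.+1%:R^-1 <= e :> R.
  have e2 : e^-1 * 2 < k.+1%:R := truncnS_gt _.
  rewrite -mulr2n -[leLHS]mulr_natl ler_pdivrMr ?ltr0n// -ler_pdivrMl// ltW//.
have k0 : 0 < k.+1%:R^-1 :> R by rewrite invr_gt0 ltr0n.
have [q hq] : exists q : 'cV[rat]_n, forall i, `|x i ord0 - ratr (q i ord0)| < k.+1%:R^-1.
  have h (i : 'I_n) : exists q : rat, `|x i ord0 - ratr q| < k.+1%:R^-1.
    have /rat_in_itvoo[q] : x i ord0 - k.+1%:R^-1 < x i ord0 + k.+1%:R^-1.
      by rewrite ltrD2l gtrN.
    by rewrite in_itv/= => hq; exists q; rewrite distrC ltr_distl.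
  have [f hf] := choice h; exists (\col_i f i) => i; rewrite mxE; exact: hf.
have bq : ball (c (q, k)) k.+1%:R^-1 x.
  split => // i j; rewrite ord1 /ball/= /ball_ /= mxE distrC; exact: hq.
exists (q, k) => //; rewrite /B; case: asboolP => //= -[]; move=> y cy; apply: xeU.
apply: (le_ball ke); apply: ball_triangle cy; exact: ball_sym.
Qed.

Lemma measurable_cVE n :
  @measurable _ 'cV[R]_n = <<s @open 'cV[R]_n >>.
Proof.
apply/seteqP; split; apply: smallest_sub.
- exact: smallest_sigma_algebra.
- rewrite -bigcup_seq => A [i _ [B mB <-]]; rewrite setTI.
  have : measurable_fun [set: g_sigma_algebraType (@open 'cV[R]_n)]
      (fun v : 'cV[R]_n => v i ord0 : measurableTypeR R).
    apply: (@measurability _ _ _ _ _ _ (@RGenOpens.G R) (RGenOpens.measurableE R)).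
    move=> _ [_ [a [b ->]] <-]; rewrite setTI; apply: sub_sigma_algebra.
    apply: open_comp; last exact: interval_open.
    by move=> v _; exact: coord_continuous.
  by move=> /(_ measurableT B mB); rewrite setTI.
- exact: sigma_algebra_measurable.
- by move=> A; exact: open_measurable_cV.
Qed.

End measurable_cV_theory.

Section lebesgue_cV.
Context (R : realType).
Local Open Scope ereal_scope.

Definition cV_cons n (xv : measurableTypeR R * 'cV[R]_n) : 'cV[R]_n.+1 :=
  col_mx (xv.1%:M : 'cV[R]_1) xv.2.

Lemma cV_cons0 n xv : @cV_cons n xv ord0 ord0 = xv.1.
Proof.
transitivity ((xv.1%:M : 'cV[R]_1) ord0 ord0); last by rewrite mxE.
rewrite -(col_mxEu (xv.1%:M : 'cV[R]_1) xv.2 ord0 ord0).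
by congr (col_mx _ _ _ _); exact: val_inj.
Qed.

Lemma cV_consS n xv (i : 'I_n) : cV_cons xv (lift ord0 i) ord0 = xv.2 i ord0.
Proof.
rewrite -(col_mxEd (xv.1%:M : 'cV[R]_1) xv.2 i ord0).
by congr (col_mx _ _ _ _); exact: val_inj.
Qed.

Lemma measurable_cV_cons n : measurable_fun setT (@cV_cons n).
Proof.
apply/measurable_fun_cVP => i; have [j ->|->] := unliftP ord0 i.
  under eq_fun do rewrite cV_consS.
  exact: measurableT_comp (measurable_coord j) measurable_snd.
by under eq_fun do rewrite cV_cons0; exact: measurable_fst.
Qed.

HB.instance Definition _ n :=
  isMeasurableFun.Build _ _ _ _ (@cV_cons n) (@measurable_cV_cons n).

Section step.
Context n (mu : {sigma_finite_measure set 'cV[R]_n -> \bar R}).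

Definition lebesgue_cV_step : set 'cV[R]_n.+1 -> \bar R :=
  pushforward (@lebesgue_measure R \x mu) (@cV_cons n).

Let step0 : lebesgue_cV_step set0 = 0.
Proof. by rewrite /lebesgue_cV_step /pushforward preimage_set0 measure0. Qed.

Let step_ge0 A : 0 <= lebesgue_cV_step A.
Proof. exact: measure_ge0. Qed.

Let step_sigma_additive : semi_sigma_additive lebesgue_cV_step.
Proof.
move=> F mF tF mUF; rewrite /lebesgue_cV_step /pushforward preimage_bigcup.
have mc (A : set 'cV[R]_n.+1) : measurable A -> measurable (@cV_cons n @^-1` A).
  by move=> mA; rewrite -[X in measurable X]setTI; exact: measurable_cV_cons.
apply: measure_semi_sigma_additive => [k||]; first exact: mc.
- apply/trivIsetP => /= i j _ _ ij; rewrite -preimage_setI.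
  by move/trivIsetP : tF => /(_ _ _ _ _ ij) ->//; rewrite preimage_set0.
- by rewrite -preimage_bigcup; exact: mc.
Qed.

HB.instance Definition _ := isMeasure.Build _ _ _ lebesgue_cV_step
  step0 step_ge0 step_sigma_additive.

Let step_sigma_finite : sigma_finite setT lebesgue_cV_step.
Proof.
pose uncons (v : 'cV[R]_n.+1) : measurableTypeR R * 'cV[R]_n :=
  (v ord0 ord0, \col_i v (lift ord0 i) ord0).
have unconsK v : cV_cons (uncons v) = v.
  apply/colP => i; have [j ->|->] := unliftP ord0 i; last by rewrite cV_cons0.
  by rewrite cV_consS mxE.
have consK xv : uncons (cV_cons xv) = xv.
  case: xv => x v; rewrite /uncons cV_cons0; congr pair.
  by apply/colP => i; rewrite mxE cV_consS.
have muncons : measurable_fun setT uncons.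
  apply/measurable_fun_pairP; split; first exact: measurable_coord.
  apply/measurable_fun_cVP => i.
  under eq_fun do rewrite mxE.
  exact: measurable_coord.
have /sigma_finiteP[F [TF ndF Foo]] := sigma_finiteT (@lebesgue_measure R).
have /sigma_finiteP[G [TG ndG Goo]] := sigma_finiteT mu.
exists (fun k => uncons @^-1` (F k `*` G k)).
  apply/seteqP; split=> // v _.
  have [i _ Fi] : (\bigcup_k F k) (uncons v).1 by rewrite -TF.
  have [j _ Gj] : (\bigcup_k G k) (uncons v).2 by rewrite -TG.
  exists (maxn i j) => //; split.
    by move: Fi; exact/subsetPset/ndF/leq_maxl.
  by move: Gj; exact/subsetPset/ndG/leq_maxr.
move=> k; have [mF Fk] := Foo k; have [mG Gk] := Goo k; split.
  by rewrite -[X in measurable X]setTI; apply: muncons => //; exact: measurableX.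
rewrite /lebesgue_cV_step /pushforward -comp_preimage.
rewrite (_ : _ \o _ = id) ?preimage_id; last exact/funext.
by rewrite product_measure1E// lte_mul_pinfty// ge0_fin_numE.
Qed.

HB.instance Definition _ :=
  Measure_isSigmaFinite.Build _ _ _ lebesgue_cV_step step_sigma_finite.

End step.

(* R^(n+1) is identified with R * R^n by cV_cons, and R^0 is a point of mass 1;
   lebesgue_cV_box below gives the usual characterization on boxes. *)
Fixpoint lebesgue_cV n : {sigma_finite_measure set 'cV[R]_n -> \bar R} :=
  match n with
  | 0%N => \d_(0%R : 'cV[R]_0)
  | n'.+1 => lebesgue_cV_step (lebesgue_cV n')
  end.

Lemma lebesgue_cV_box n (A : 'I_n -> set R) :
  (forall i, measurable (A i : set (measurableTypeR R))) ->
  lebesgue_cV n [set v | forall i, A i (v i ord0)] =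
  \prod_(i < n) lebesgue_measure (A i).
Proof.
elim: n A => [|n IHn] A mA.
  by rewrite big_ord0 /= diracE mem_set// => -[].
have mB : measurable [set v : 'cV[R]_n | forall i, A (lift ord0 i) (v i ord0)].
  rewrite (_ : mkset _ = \bigcap_(i in [set: 'I_n])
      ((fun v : 'cV[R]_n => v i ord0) @^-1` A (lift ord0 i))); last first.
    by apply/seteqP; split=> [v vA i _|v vA i]; exact: vA.
  apply: fin_bigcap_measurable => // i _.
  by rewrite -[X in measurable X]setTI; exact: measurable_coord.
rewrite /= /lebesgue_cV_step /pushforward big_ord_recl -IHn//.
rewrite -product_measure1E//; congr (_ _); apply/seteqP; split=> -[x v] /=.
  move=> vA; split; first by have := vA ord0; rewrite cV_cons0.
  by move=> i; have := vA (lift ord0 i); rewrite cV_consS.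
move=> [xA vA] i; have [j ->|->] := unliftP ord0 i; last by rewrite cV_cons0.
by rewrite cV_consS; exact: vA.
Qed.

End lebesgue_cV.

Definition msupport (T : topologicalType) (R : realType)
    (mu : set T -> \bar R) : set T :=
  [set z | forall U, open U -> U z -> (0 < mu U)%E].

(* f is bounded everywhere: a density bounded only almost everywhere can be
   truncated without changing mu. *)
Definition has_bounded_density (R : realType) s
    (mu : set 'cV[R]_s -> \bar R) : Prop :=
  exists2 f : 'cV[R]_s -> measurableTypeR R,
    measurable_fun setT f /\ (exists C : R, forall z, 0 <= f z <= C) &
    forall A, measurable A -> mu A = (\int[lebesgue_cV R s]_(z in A) (f z)%:E)%E.

Section second_stage.
Context (R : realType) (m s : nat).
Variables (W : 'M[R]_(s, m)) (q d : 'cV[R]_m) (Y : set 'cV[R]_m).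

Definition dot (u v : 'cV[R]_m) : R := (u^T *m v) ord0 ord0.

Definition integer_points : set 'cV[R]_m :=
  Y `&` [set y | forall i, y i ord0 \is a Num.int].

Definition feasible (t : 'cV[R]_s) : set 'cV[R]_m :=
  [set y | integer_points y /\ forall i, (W *m y) i ord0 <= t i ord0].

Definition Psi (t : 'cV[R]_s) : set 'cV[R]_m :=
  [set y | feasible t y /\ forall y', feasible t y' -> dot d y <= dot d y'].

Definition phi (t : 'cV[R]_s) : \bar R :=
  ereal_inf [set (dot q y)%:E | y in Psi t].

Definition dom_phi : set 'cV[R]_s := [set t | phi t \is a fin_num].

Lemma phi_code : finite_set integer_points ->
  exists k : nat, exists y : 'I_k -> 'cV[R]_m,
  exists g : {ffun 'I_k -> bool} -> \bar R,
  forall t, phi t =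
    g [ffun i => [forall j, (W *m y i) j ord0 <= t j ord0]].
Proof.
move=> /finite_seqP[l lE].
pose y (i : 'I_(size l)) := tnth (in_tuple l) i.
pose c (t : 'cV[R]_s) : {ffun 'I_(size l) -> bool} :=
  [ffun i => [forall j, (W *m y i) j ord0 <= t j ord0]].
have ceq t t' : c t = c t' -> phi t = phi t'.
  move=> tt'.
  have sub t1 t2 : c t1 = c t2 -> feasible t1 `<=` feasible t2.
    move=> c12 z [Zz Wz]; split=> //.
    have /(nthP z)[i il zE] : z \in l by move: Zz; rewrite lE.
    move/ffunP : c12 => /(_ (Ordinal il)).
    rewrite !ffunE /y (tnth_nth z)/= zE => h.
    by apply/forallP; rewrite -h; exact/forallP.
  have feq : feasible t = feasible t' by apply/seteqP; split; exact: sub.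
  by rewrite /phi /Psi feq.
exists (size l), y, (fun b => phi (xget 0 [set t | c t = b])) => t.
by apply: ceq; apply/esym; apply: (@xgetPex _ 0 [set t' | c t' = c t]); exists t.
Qed.

End second_stage.

Section recourse.
Context (R : realType) disp (Omega : measurableType disp).
Context (P : probability Omega R).
Variables (n m s : nat) (T : 'M[R]_(s, n)) (W : 'M[R]_(s, m)).
Variables (q d : 'cV[R]_m) (Y : set 'cV[R]_m).
Variable Z : {RV P >-> 'cV[R]_s}.

Definition F_Z : set 'cV[R]_n :=
  [set x | forall z, msupport (distribution P Z) z ->
                     dom_phi W q d Y (T *m x + z)].

(* For x in F_Z, phi (T x + Z) is finite almost surely; fine replaces the value
   by 0 on the null event where Z lies outside its support and phi = +oo. *)
Definition recourse (x : 'cV[R]_n) : Omega -> R :=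
  fun w => fine (phi W q d Y (T *m x + Z w)).

Lemma recourse_Lfun (p : R) (p1 : (1 <= p%:E)%E) x :
  finite_set (integer_points Y) -> recourse x \in Lfun P p%:E.
Proof.
move=> /(phi_code W q d)[k [y [g phiE]]].
pose c w : {ffun 'I_k -> bool} :=
  [ffun i => [forall j, (W *m y i) j ord0 <= (T *m x + Z w) j ord0]].
have recE w : recourse x w = fine (g (c w)) by rewrite /recourse phiE.
have mrec : measurable_fun setT (recourse x : Omega -> measurableTypeR R).
  move=> _ B mB; rewrite setTI.
  rewrite (_ : _ @^-1` B = \bigcup_(b in [set b | B (fine (g b))])
      \bigcap_(i in [set: 'I_k]) [set w | c w i = b i]); last first.
    apply/seteqP; split=> [w Bw|w [b Bb cb]] /=.
      by exists (c w) => //=; rewrite -recE.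
    by rewrite recE (_ : c w = b)//; apply/ffunP => i; exact: cb.
  apply: fin_bigcup_measurable => // b _.
  apply: fin_bigcap_measurable => // i _.
  have mE : measurable [set w | c w i].
    rewrite (_ : mkset _ = \bigcap_(j in [set: 'I_s])
        ((fun w => Z w j ord0 : measurableTypeR R) @^-1`
          `[(W *m y i) j ord0 - (T *m x) j ord0, +oo[%classic)).
      apply: fin_bigcap_measurable => // j _.
      rewrite -[X in measurable X]setTI.
      have := (measurable_fun_cVP (Z : Omega -> 'cV[R]_s)).1 (measurable_funPT Z) j.
      by apply => //; exact: measurable_itv.
    apply/seteqP; split=> w /=; rewrite ffunE.
      move=> /forallP cw j _ /=; have := cw j.
      by rewrite [(_ + Z w) j _]mxE in_itv/= andbT lerBlDl.
    move=> cw; apply/forallP => j; have := cw j I.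
    by rewrite /= [(_ + Z w) j _]mxE in_itv/= andbT lerBlDl.
  case: (b i); first by [].
  rewrite (_ : mkset _ = ~` [set w | c w i]); first exact: measurableC.
  by apply/seteqP; split=> w /=; case: (c w i).
pose M : R := \sum_b `|fine (g b)|.
have recM w : `|recourse x w| <= M.
  by rewrite recE /M (bigD1 (c w))//= lerDl sumr_ge0.
rewrite inE/=; apply/andP; split; rewrite inE//=.
rewrite /finite_norm unlock poweR_lty//.
have p0 : 0 < p by rewrite (lt_le_trans ltr01).
have M0 : 0 <= M by exact: sumr_ge0.
apply: (@le_lt_trans _ _ (\int[P]_w (M `^ p)%:E)%E).
  apply: ge0_le_integral => //=.
  - apply/measurable_EFinP.
    apply: (measurableT_comp (measurable_powR p)) => //.
    exact: measurableT_comp.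
  - by move=> w _; rewrite lee_fin ge0_ler_powR// ?nnegrE// ltW.
by rewrite integral_cst// [X in (_ * X)%E]probability_setT mule1 ltry.
Qed.

Definition recourse_Lp (p : R) (p1 : (1 <= p%:E)%E)
    (finY : finite_set (integer_points Y)) (x : 'cV[R]_n) : LfunType P p1 :=
  Lfun_Sub p1 (recourse_Lfun p1 x finY).

End recourse.

(* LfunType P p1 is the space of p-integrable functions, on which the L^p norm
   is a seminorm, and not its quotient by almost sure equality (LspaceType has
   no vector space structure).  Each of the properties risk_continuous,
   risk_lipschitz and risk_nondecreasing forces rho to be constant on the
   classes of almost surely equal functions. *)
Section risk.
Context (R : realType) disp (Omega : measurableType disp).
Context (P : probability Omega R).
Context (p : R) (p1 : (1 <= p%:E)%E).
Implicit Types (rho : LfunType P p1 -> R) (X : LfunType P p1).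

Definition Lp_dist X X' : R := fine ('N[P]_p%:E[EFin \o (X - X')%R])%E.

Definition Lp_cst (a : R) : LfunType P p1 := Lfun_Sub p1 (Lfun_cst P a p).

Definition risk_convex rho := convex_function [set: LfunType P p1] rho.

Definition risk_continuous rho := forall X (e : R), 0 < e ->
  exists2 del : R, 0 < del &
    forall X', Lp_dist X X' < del -> `|rho X - rho X'| < e.

Definition risk_lipschitz rho := exists2 L : R, 0 <= L &
  forall X X', `|rho X - rho X'| <= L * Lp_dist X X'.

Definition risk_nondecreasing rho :=
  forall X1 X2, {ae P, forall w, X1 w <= X2 w} -> rho X1 <= rho X2.

Definition translation_equivariant rho :=
  forall X a, rho (X + Lp_cst a) = rho X + a.

Definition positively_homogeneous rho :=
  forall X (l : R), 0 <= l -> rho (l *: X) = l * rho X.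

Definition convex_risk_measure rho :=
  [/\ risk_convex rho, risk_nondecreasing rho & translation_equivariant rho].

Definition coherent_risk_measure rho :=
  convex_risk_measure rho /\ positively_homogeneous rho.

End risk.

Section hoelder.
Context (R : realType) (n : nat).
Implicit Types (A : set 'cV[R]_n) (a : R) (g : 'cV[R]_n -> R).

Definition hoelder_on A a g := exists2 L : R, 0 <= L &
  forall x x', A x -> A x' -> `|g x - g x'| <= L * `|x - x'| `^ a.

Definition locally_hoelder_on A a g := forall x, A x ->
  exists2 U, nbhs x U & hoelder_on (U `&` A) a g.

End hoelder.

(* Main.v *)
Require Import Defs.
From HB Require Import structures.
From mathcomp Require Import all_boot all_order all_algebra.
From mathcomp Require Import all_classical all_reals all_analysis.
From mathcomp Require Import measurable_realfun ring lra.
Set Implicit Arguments.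
Unset Strict Implicit.
Unset Printing Implicit Defensive.
Import Order.TTheory GRing.Theory Num.Theory.
Import numFieldNormedType.Exports.
Local Open Scope classical_set_scope.
Local Open Scope ring_scope.

(** The optimal second-stage decision is selected by comparing the finitely many
    integer points with the right-hand side t = T x + Z, so phi t depends only
    on the outcome of the finitely many tests (W y_i)_j <= t_j (phi_code).  In
    particular the recourse takes finitely many values, say of modulus at most
    M, and moving from x to x' changes it only if, for some i and j, the
    coordinate Z_j falls between the thresholds (W y_i - T x)_j and
    (W y_i - T x')_j.  The law of Z lives on a bounded box, where its density
    is bounded, so that such a slab has mass at most a constant times its width
    (bounded_density_slab), and the width is at most a constant times
    |x - x'|.  Hence the recourses at x and x' differ with probability
    O(|x - x'|), and by at most 2 M, which gives
    E |F(x) - F(x')|^p = O(|x - x'|): the map F from R^n to L^p is Hoelder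
    continuous with exponent 1/p (recourse_Lp_dist_hoelder).

    It remains to see that the functional rho is Lipschitz, locally or globally,
    for the L^p seminorm.  A convex function that is bounded above near a point
    is Lipschitz near that point (convex_bounded_above_lipschitz).  Continuity
    provides the upper bound at once.  So does monotonicity, by completeness of
    L^p: were rho unbounded above near X0, one could find X_n -> X0 so fast that
    the X_n have a common majorant X0 + V in L^p while rho X_n > n, although
    rho X_n <= rho (X0 + V) (nondecreasing_locally_bounded_above).  For a
    coherent rho, scaling turns the Lipschitz bound near 0 into a global one on
    X |-> rho X, and sublinearity extends it to differences
    (sublinear_bounded_above_lipschitz). *)

(** * Convex functions on a seminormed space *)

Section seminorm_convex.
Context (R : realType) (V : lmodType R) (N : V -> R).
Hypothesis ND : forall u v, N (u + v) <= N u + N v.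
Hypothesis NZ : forall (a : R) u, N (a *: u) = `|a| * N u.

Lemma convex_function_le (f : V -> R) (t : R) (u v : V) : 0 <= t -> t <= 1 ->
  convex_function setT f ->
  f (t *: u + (1 - t) *: v) <= t * f u + (1 - t) * f v.
Proof.
move=> t0 t1 cf.
by have := cf (Itv01 t0 t1) u v; rewrite !inE => /(_ I I).
Qed.

Lemma seminorm_distC u v : N (u - v) = N (v - u).
Proof. by rewrite -(opprB v u) -(scaleN1r (v - u)) NZ normrN1 mul1r. Qed.

Lemma seminorm0 : N 0 = 0.
Proof. by rewrite -[X in N X](scale0r (0 : V)) NZ normr0 mul0r. Qed.

Lemma seminorm_ge0 u : 0 <= N u.
Proof.
have := ND u (- u); rewrite subrr seminorm0 -(scaleN1r u) NZ normrN1 mul1r; lra.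
Qed.

(** Reflecting a point u through u0 turns the upper bound C into a lower bound
    c = 2 f(u0) - C, so f oscillates by at most C - c on the ball of radius del.
    A segment inside the ball of radius del / 2 can be prolonged by del / 2
    without leaving the larger ball, and convexity then bounds the slope along
    the segment by (C - c) / (del / 2). *)
Lemma convex_bounded_above_lipschitz (f : V -> R) u0 (C del : R) : 0 < del ->
  convex_function setT f -> (forall u, N (u - u0) < del -> f u <= C) ->
  exists2 L, 0 <= L & forall u v, N (u - u0) < del / 2 ->
    N (v - u0) < del / 2 -> `|f u - f v| <= L * N (u - v).
Proof.
move=> del0 cf fC.
pose c := 2 * f u0 - C.
have fc u : N (u - u0) < del -> c <= f u.
  move=> ud.
  have vd : N ((2%:R *: u0 - u) - u0) < del.
    by rewrite scaler_nat mulr2n addrAC addrK seminorm_distC.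
  have [h0 h1] : 0 <= 2^-1 :> R /\ 2^-1 <= 1 :> R by lra.
  have := convex_function_le u (2%:R *: u0 - u) h0 h1 cf.
  rewrite (_ : _ *: u + _ = u0); last first.
    have -> : 1 - 2^-1 = 2^-1 :> R by lra.
    by rewrite -scalerDr addrC subrK scalerA mulVf// scale1r.
  have := fC _ vd; rewrite /c; lra.
have Cc : 0 <= C - c.
  have u0d : N (u0 - u0) < del by rewrite subrr seminorm0.
  by have := fC _ u0d; have := fc _ u0d; lra.
pose L := 2 * (C - c) / del.
have L0 : 0 <= L by rewrite divr_ge0 ?mulr_ge0// ltW.
exists L => //.
have half u v : N (u - u0) < del / 2 -> N (v - u0) < del / 2 ->
    f v - f u <= L * N (u - v).
  move=> ud vd; apply/ler_addgt0Pr => e e0.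
  (* N may vanish at u - v, so the slope is bounded with a positive number r
     slightly larger than N (u - v) in place of N (u - v) *)
  pose r := N (u - v) + e / (L + 1).
  have r0 : 0 < r by rewrite ltr_wpDl ?seminorm_ge0// divr_gt0// ltr_wpDl.
  apply: (@le_trans _ _ (L * r)); last first.
    rewrite /r mulrDr lerD2l mulrCA ger_pMr// ler_pdivrMr ?ltr_wpDl// mul1r.
    by rewrite lerDl.
  (* v is the convex combination, with weight l / (1 + l) <= l on w, of u and
     of the point w beyond v on the ray from u, which lies in the ball where
     c <= f <= C *)
  pose l := 2 * r / del.
  have l0 : 0 < l by rewrite divr_gt0// mulr_gt0.
  pose w := v + l^-1 *: (v - u).
  have wd : N (w - u0) < del.
    rewrite /w addrAC; apply: le_lt_trans (ND _ _) _.
    rewrite NZ ger0_norm ?invr_ge0 ?ltW// seminorm_distC.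
    suff : l^-1 * N (u - v) <= del / 2 by rewrite seminorm_distC; lra.
    have -> : l^-1 * N (u - v) = del / 2 * (N (u - v) / r).
      by rewrite /l; field; rewrite !gt_eqF.
    rewrite ger_pMr ?divr_gt0// ler_pdivrMr// mul1r lerDl.
    by rewrite divr_ge0 ?ltW// ltr_wpDl.
  have l1 : 0 < 1 + l by rewrite addr_gt0.
  have h0 : 0 <= l / (1 + l) by rewrite divr_ge0 ?ltW.
  have h1 : l / (1 + l) <= 1 by rewrite ler_pdivrMr// mul1r; lra.
  have := convex_function_le w u h0 h1 cf.
  have vE : (l / (1 + l)) *: w + (1 - l / (1 + l)) *: u = v.
    have -> : 1 - l / (1 + l) = (1 + l)^-1 by field; rewrite gt_eqF.
    rewrite [l / _]mulrC -scalerA -scalerDr [l *: w]scalerDr scalerA.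
    rewrite mulfV ?gt_eqF//.
    have -> : l *: v + 1 *: (v - u) + u = (1 + l) *: v.
      by rewrite scale1r -addrA subrK scalerDl scale1r addrC.
    by rewrite scalerA mulVf ?scale1r ?gt_eqF.
  rewrite vE => vle.
  have : f v - f u <= l / (1 + l) * (C - c).
    have : l / (1 + l) * (f w - f u) <= l / (1 + l) * (C - c).
      apply: ler_wpM2l => //; apply: lerB; first exact: fC.
      by apply: fc; lra.
    lra.
  move/le_trans; apply.
  have -> : L * r = l * (C - c) by rewrite /L /l; field; rewrite gt_eqF.
  by rewrite ler_wpM2r// ler_pdivrMr// ler_peMr ?ltW//; lra.
move=> u v ud vd; rewrite ler_norml lerNl opprB half//=.
by rewrite seminorm_distC half.
Qed.

(** Homogeneity transports the Lipschitz bound |f(t u)| <= L N(t u), valid for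
    small t > 0, to f(u) <= L N(u); with convexity it makes f subadditive, so
    that f(u) - f(v) <= f(u - v). *)
Lemma sublinear_bounded_above_lipschitz (f : V -> R) (C del : R) : 0 < del ->
  convex_function setT f ->
  (forall u (l : R), 0 <= l -> f (l *: u) = l * f u) ->
  (forall u, N u < del -> f u <= C) ->
  exists2 L, 0 <= L & forall u v, `|f u - f v| <= L * N (u - v).
Proof.
move=> del0 cf fZ fC.
have f0 : f 0 = 0 by rewrite -(scale0r 0) fZ// mul0r.
have [L L0 fL] : exists2 L, 0 <= L & forall u v, N (u - 0) < del / 2 ->
    N (v - 0) < del / 2 -> `|f u - f v| <= L * N (u - v).
  apply: convex_bounded_above_lipschitz cf _ => // u; rewrite subr0.
  exact: fC.
exists L => //.
have fle u : f u <= L * N u.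
  (* small enough for t u to have seminorm below del / 2 *)
  pose t := del / (4 * (N u + 1)).
  have N1 : 0 < N u + 1 by rewrite ltr_wpDl// seminorm_ge0.
  have t0 : 0 < t by rewrite divr_gt0// mulr_gt0.
  have tu : N (t *: u - 0) < del / 2.
    rewrite subr0 NZ gtr0_norm//.
    have -> : t * N u = del / 4 * ((N u + 1)^-1 * N u).
      by rewrite /t; field; rewrite gt_eqF.
    have le1 : (N u + 1)^-1 * N u <= 1.
      by rewrite mulrC ler_pdivrMr// mul1r lerDl.
    have : (del / 4) * ((N u + 1)^-1 * N u) <= del / 4.
      by rewrite ger_pMr ?divr_gt0.
    lra.
  have z : N (0 - 0 : V) < del / 2.
    by rewrite subr0 seminorm0 divr_gt0.
  have := fL _ _ tu z; rewrite f0 !subr0 (fZ _ _ (ltW t0)) NZ (gtr0_norm t0).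
  by move=> /(le_trans (ler_norm _)); rewrite [L * _]mulrCA ler_pM2l.
have fD u v : f (u + v) <= f u + f v.
  have [h0 h1] : 0 <= 2^-1 :> R /\ 2^-1 <= 1 :> R by lra.
  have := convex_function_le u v h0 h1 cf.
  have -> : 1 - 2^-1 = 2^-1 :> R by lra.
  by rewrite -scalerDr fZ ?invr_ge0// -mulrDr ler_pM2l ?invr_gt0.
move=> u v; rewrite ler_norml lerNl opprB; apply/andP; split.
  have := fD (v - u) u; have := fle (v - u).
  by rewrite subrK seminorm_distC; lra.
by have := fD (u - v) v; have := fle (u - v); rewrite subrK; lra.
Qed.

End seminorm_convex.

(** * Monotone functionals on L^p *)

Section Lp_order.
Context (R : realType) disp (Omega : measurableType disp).
Context (P : probability Omega R).
Context (p : R) (p1 : (1 <= p%:E)%E).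
Implicit Types (rho : LfunType P p1 -> R) (X : LfunType P p1).

Let Nm X : R := fine ('N[P]_p%:E[EFin \o X])%E.

Let p_gt0 : 0 < p.
Proof. by rewrite (lt_le_trans ltr01). Qed.

Lemma Lp_seminormD X X' : Nm (X + X') <= Nm X + Nm X'.
Proof. exact: ler_LnormD. Qed.

Lemma Lp_seminormZ (a : R) X : Nm (a *: X) = `|a| * Nm X.
Proof.
by apply: EFin_inj; rewrite EFinM !finite_norm_fine; exact: LnormZ.
Qed.

Lemma Lp_seminorm_powR X :
  (Nm X `^ p)%:E = (\int[P]_w (`|X w| `^ p)%:E)%E.
Proof.
by rewrite -poweR_EFin finite_norm_fine poweR_Lnorm ?gt_eqF.
Qed.

(** The majorant is V = (sum_n |X_n|^p)^(1/p): it dominates every |X_n| because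
    each of them is one of the nonnegative summands, and E V^p is the sum of the
    E |X_n|^p by monotone convergence.  The outer fine only matters on the null
    event where the series diverges. *)
Lemma Lp_powR_dominated (X : (LfunType P p1)^nat) :
  (\sum_(n <oo) (Nm (X n) `^ p)%:E < +oo)%E ->
  exists V : LfunType P p1, {ae P, forall w, forall n, `|X n w| <= V w}.
Proof.
move=> Xoo.
pose h w := (\sum_(n <oo) (`|X n w| `^ p)%:E)%E.
have mXp n : measurable_fun setT (fun w => (`|X n w| `^ p)%:E).
  apply/measurable_EFinP; apply: (measurableT_comp (measurable_powR p)) => //.
  exact: measurableT_comp.
have mh : measurable_fun setT h.
  by apply: ge0_emeasurable_sum => // n w _ _; rewrite lee_fin powR_ge0.
have h0 w : (0 <= h w)%E.
  by apply: nneseries_ge0 => n _ _; rewrite lee_fin powR_ge0.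
have inth : (\int[P]_w h w < +oo)%E.
  rewrite integral_nneseries => [|||n w _]; rewrite ?lee_fin ?powR_ge0//.
  by under eq_eseriesr => n _ do rewrite -Lp_seminorm_powR.
have ih : P.-integrable setT h.
  apply/integrableP; split=> //.
  by under eq_integral do rewrite gee0_abs//.
pose v w := fine (h w) `^ p^-1.
have mv : measurable_fun setT v.
  apply: (measurableT_comp (measurable_powR _)) => //.
  exact: (measurableT_comp (fine_measurable measurableT)).
have vL : v \in Lfun P p%:E.
  rewrite inE/=; apply/andP; split; rewrite inE//=.
  rewrite /finite_norm unlock poweR_lty//.
  apply: le_lt_trans inth; apply: ge0_le_integral => //=.
  - apply/measurable_EFinP.
    apply: (measurableT_comp (measurable_powR p)) => //.
    exact: measurableT_comp.
  move=> w _; rewrite ger0_norm ?powR_ge0// /v -powRrM mulVf ?gt_eqF//.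
  rewrite powRr1 ?fine_ge0//.
  by have := h0 w; case: (h w) => //= _; rewrite leey.
exists (Lfun_Sub p1 vL).
have := integrable_ae measurableT ih; apply: filterS => w /(_ I) hw n /=.
have -> : `|X n w| = (`|X n w| `^ p) `^ p^-1.
  by rewrite -powRrM mulfV ?gt_eqF// powRr1.
rewrite /v ge0_ler_powR ?invr_ge0 ?(ltW p_gt0)// ?nnegrE ?powR_ge0 ?fine_ge0//.
rewrite -lee_fin fineK// /h.
apply: le_trans (nneseries_lim_ge n.+1 _) => [|k _ _]; last first.
  by rewrite lee_fin powR_ge0.
by rewrite big_nat_recr//= leeDr// sume_ge0// => k _; rewrite lee_fin powR_ge0.
Qed.

(** A monotone functional cannot exceed n at some X_n for every n if all the X_n
    lie below a single X0 + V of L^p, and such a V exists as soon as the X_n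
    converge to X0 fast enough. *)
Lemma nondecreasing_locally_bounded_above rho X0 : risk_nondecreasing rho ->
  exists2 del : R, 0 < del &
  exists C, forall X, Lp_dist X X0 < del -> rho X <= C.
Proof.
move=> nd; apply: contrapT => unb.
(* at most 1 and summable, so that the p-th powers are summable as well *)
pose del n : R := 1 / (2 ^ n.+1)%:R.
have del0 n : 0 < del n by rewrite divr_gt0// ltr0n expn_gt0.
have del1 n : del n <= 1.
  by rewrite ler_pdivrMr ?ltr0n ?expn_gt0// mul1r ler1n expn_gt0.
have ex n : exists X, Lp_dist X X0 < del n /\ n%:R < rho X.
  apply: contrapT => nX; apply: unb; exists (del n) => //.
  exists n%:R => X Xd; rewrite leNgt; apply/negP => nrho; apply: nX.
  by exists X.
have [X hX] := choice ex.
have [V VX] : exists V : LfunType P p1,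
    {ae P, forall w, forall n, `|(X n - X0) w| <= V w}.
  apply: Lp_powR_dominated.
  apply: (@le_lt_trans _ _ (\sum_(n <oo) (del n)%:E)%E).
    apply: lee_nneseries => [n _ _|n _]; rewrite lee_fin; first exact: powR_ge0.
    have Nd : Nm (X n - X0) <= del n by exact/ltW/(hX n).1.
    apply: le_trans (ge0_ler_powR (ltW p_gt0) _ _ Nd) _.
    - by rewrite nnegrE; apply/fine_ge0/Lnorm_ge0.
    - by rewrite nnegrE ltW.
    by apply: ge1r_powR; rewrite ?del0 ?del1.
  by apply: le_lt_trans (epsilon_trick0 xpredT ler01) _; rewrite ltry.
have := (hX (Num.truncn (rho (X0 + V))).+1).2; apply/negP; rewrite -leNgt.
apply: le_trans (_ : rho (X0 + V) <= _); last exact/ltW/truncnS_gt.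
apply: nd; move: VX; apply: filterS => w Vw.
have := Vw (Num.truncn (rho (X0 + V))).+1 => /(le_trans (ler_norm _)) /=.
by rewrite lerBlDl.
Qed.

Lemma Lp_distC X X' : Lp_dist X X' = Lp_dist X' X.
Proof. exact: seminorm_distC Lp_seminormZ X X'. Qed.

Lemma coherent_risk_lipschitz rho :
  coherent_risk_measure rho -> risk_lipschitz rho.
Proof.
move=> [[cvx nd _] ph].
have [del del0 [C rhoC]] := nondecreasing_locally_bounded_above 0 nd.
apply: (sublinear_bounded_above_lipschitz
  Lp_seminormD Lp_seminormZ del0 cvx ph).
by move=> X Xdel; apply: rhoC; rewrite /Lp_dist subr0; exact: Xdel.
Qed.

End Lp_order.

(** * Laws with a bounded density and a compact support *)

Lemma measure_bigsetU_le d (T : measurableType d) (R : realType)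
    (mu : {measure set T -> \bar R}) (I : Type) (r : seq I) (A : I -> set T) :
  (forall i, measurable (A i)) ->
  (mu (\big[setU/set0]_(i <- r) A i) <= \sum_(i <- r) mu (A i))%E.
Proof.
move=> mA; elim: r => [|i r IHr]; first by rewrite !big_nil measure0.
rewrite !big_cons; apply: le_trans (measureU2 _ _ _) _ => //.
  exact: bigsetU_measurable.
exact: leeD.
Qed.

Section slab.
Context (R : realType) (s : nat).

Let rational_ball (i : 'cV[rat]_s * nat) : set 'cV[R]_s :=
  ball (map_mx ratr i.1 : 'cV[R]_s) i.2.+1%:R^-1.

Lemma ler_coord_mx_norm (v : 'cV[R]_s) i : `|v i ord0| <= `|v|.
Proof.
rewrite [leRHS]/Num.norm /= mx_normrE; apply/bigmax_geP; right.
by exists (i, ord0).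
Qed.

Lemma rational_ball_basis (x : 'cV[R]_s) (U : set 'cV[R]_s) : nbhs x U ->
  exists i, rational_ball i x /\ rational_ball i `<=` U.
Proof.
move=> /nbhs_ballP[e /= e0 xeU].
have [k ke] : exists k, k.+1%:R^-1 + k.+1%:R^-1 <= e :> R.
  exists (Num.truncn (2 / e)); have := truncnS_gt (2 / e).
  rewrite -mulr2n -[leLHS]mulr_natl ler_pdivrMr ?ltr0n// ltr_pdivrMr// mulrC.
  exact: ltW.
have k0 : 0 < k.+1%:R^-1 :> R by rewrite invr_gt0 ltr0n.
have h (i : 'I_s) : exists q : rat, `|x i ord0 - ratr q| < k.+1%:R^-1.
  have /rat_in_itvoo[q] : x i ord0 - k.+1%:R^-1 < x i ord0 + k.+1%:R^-1.
    by rewrite ltrD2l gtrN.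
  by rewrite in_itv/= => hq; exists q; rewrite distrC ltr_distl.
have [f hf] := choice h.
have bx : rational_ball (\col_i f i, k) x.
  by split=> // i j; rewrite ord1 /ball/= /ball_ /= !mxE distrC.
exists (\col_i f i, k); split=> // y cy; apply: xeU.
by apply: (le_ball ke); apply: ball_triangle cy; exact: ball_sym.
Qed.

(** Each point outside the support has a null open neighborhood, hence lies in a
    null ball with rational center and radius 1 / (k + 1); there are countably
    many such balls. *)
Lemma negligible_setC_msupport (mu : {measure set 'cV[R]_s -> \bar R}) :
  mu.-negligible (~` msupport mu).
Proof.
pose N i := if mu (rational_ball i) == 0%E then rational_ball i else set0.
have nN i : mu.-negligible (N i).
  rewrite /N; case: ifPn => [/eqP B0|_]; last exact: negligible_set0.
  by apply/negligibleP => //; exact: measurable_ball_cV.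
(* the same family, indexed by the natural numbers *)
pose G k := if unpickle k is Some i then N i else set0.
have nG k : mu.-negligible (G k).
  by rewrite /G; case: unpickle => [i|]; [exact: nN|exact: negligible_set0].
apply: negligibleS (negligible_bigcup nG) => z /= /existsNP[U].
move=> /not_implyP[oU] /not_implyP[Uz /negP U0].
have [i [iz iU]] := rational_ball_basis (open_nbhs_nbhs (conj oU Uz)).
exists (pickle i) => //; rewrite /G pickleK /N.
suff -> : mu (rational_ball i) == 0%E by [].
rewrite eq_le measure_ge0 andbT.
apply: le_trans (_ : (mu U <= 0)%E); last by rewrite leNgt.
by apply: le_measure; rewrite ?inE//; [exact: measurable_ball_cV|
  exact: open_measurable_cV].
Qed.

Lemma measurable_slab (j : 'I_s) (a b : R) :
  measurable [set z : 'cV[R]_s | a <= z j ord0 < b].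
Proof.
rewrite (_ : mkset _ = (fun v : 'cV[R]_s => v j ord0) @^-1` `[a, b[%classic).
  by rewrite -[X in measurable X]setTI; apply: measurable_coord.
by apply/seteqP; split=> v /=; rewrite in_itv.
Qed.

(** Compactness confines mu to a cube [-M, M]^s; the slab meets it in a box of
    volume (2 M)^(s-1) (b - a). *)
Lemma bounded_density_slab (mu : {measure set 'cV[R]_s -> \bar R}) :
  has_bounded_density mu -> compact (msupport mu) ->
  exists2 K : R, 0 <= K & forall j a b, a <= b ->
    (mu [set z | (a <= z j ord0 < b)%R] <= (K * (b - a))%:E)%E.
Proof.
move=> [f [mf [C fC]] fE] /compact_bounded/pinfty_ex_gt0[M /= M0 suppM].
have C0 : 0 <= C by have /andP[] := fC 0; exact: le_trans.
exists (C * (2 * M) ^+ s.-1).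
  by rewrite mulr_ge0// exprn_ge0// mulr_ge0// ltW.
move=> j a b ab.
pose A (i : 'I_s) : set R :=
  if i == j then `[a, b[%classic else `[-M, M]%classic.
have mA i : measurable (A i : set (measurableTypeR R)).
  by rewrite /A; case: ifP => _; exact: measurable_itv.
pose box := [set v : 'cV[R]_s | forall i, A i (v i ord0)].
have mbox : measurable box.
  rewrite (_ : box = \bigcap_(i in [set: 'I_s])
      ((fun v : 'cV[R]_s => v i ord0) @^-1` A i)); last first.
    by apply/seteqP; split=> [v vA i _|v vA i]; exact: vA.
  apply: fin_bigcap_measurable => // i _.
  by rewrite -[X in measurable X]setTI; exact: measurable_coord.
have [N [mN N0 suppN]] := negligible_setC_msupport mu.
apply: (@le_trans _ _ (mu (box `|` N))).
  apply: le_measure; rewrite ?inE.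
  - exact: measurable_slab.
  - exact: measurableU.
  move=> z /= zab; case: (pselect (msupport mu z)) => [zs|]; last first.
    by right; exact: suppN.
  left=> i; rewrite /A; case: eqP => [->|_] /=; rewrite in_itv//=.
  by rewrite -ler_norml; apply: le_trans (suppM _ zs); exact: ler_coord_mx_norm.
apply: (@le_trans _ _ (mu box)).
  by apply: le_trans (measureU2 _ mbox mN) _; rewrite [X in (_ + X)%E]N0 adde0.
rewrite fE//.
apply: (@le_trans _ _ (\int[lebesgue_cV R s]_(z in box) (cst C%:E z))%E).
  apply: ge0_le_integral => //.
  - by move=> z _; rewrite lee_fin; have /andP[] := fC z.
  - by apply/measurable_EFinP; apply: measurable_funTS.
  - by move=> z _; rewrite lee_fin; have /andP[] := fC z.
have boxE : lebesgue_cV R s box = ((2 * M) ^+ s.-1 * (b - a))%:E.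
  apply: etrans (lebesgue_cV_box mA) _.
  rewrite (eq_bigr (fun i => (if i == j then b - a else 2 * M)%:E)); last first.
    move=> i _; rewrite /A; case: ifP => _.
      rewrite lebesgue_measure_itv/= lte_fin.
      by case: ltgtP ab => // -> _; rewrite subrr.
    rewrite lebesgue_measure_itv/= lte_fin gtrN// opprK -EFinD.
    by rewrite mulr_natl mulr2n.
  rewrite prodEFin (bigD1 j)//= eqxx mulrC.
  rewrite (eq_bigr (fun=> 2 * M)) => [|i /negbTE ->//].
  by rewrite prodr_const cardC1 card_ord.
by rewrite integral_cst// [X in (_ * X)%E]boxE -mulrA -EFinM.
Qed.

End slab.

(** * The recourse as a Hoelder continuous map into L^p *)

Section recourse_hoelder.
Context (R : realType) disp (Omega : measurableType disp).
Context (P : probability Omega R).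
Variables (n m s : nat) (T : 'M[R]_(s, n)) (W : 'M[R]_(s, m)).
Variables (q d : 'cV[R]_m) (Y : set 'cV[R]_m).
Variable Z : {RV P >-> 'cV[R]_s}.
Hypothesis finY : finite_set (integer_points Y).

Lemma threshold_change (b t t' z : R) : (b <= t + z) != (b <= t' + z) ->
  b - Num.max t t' <= z < b - Num.min t t'.
Proof.
have [tt'|t't] := leP t t'.
  by case: (leP b (t + z)); case: (leP b (t' + z)) => //; lra.
by case: (leP b (t + z)); case: (leP b (t' + z)) => //; lra.
Qed.

Lemma ler_coord_mulmx (x : 'cV[R]_n) j :
  `|(T *m x) j ord0| <= (\sum_(l < n) `|T j l|) * `|x|.
Proof.
rewrite mxE; apply: le_trans (ler_norm_sum _ _ _) _.
rewrite mulr_suml; apply: ler_sum => l _; rewrite normrM.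
by apply: ler_wpM2l => //; exact: ler_coord_mx_norm.
Qed.

Lemma recourse_bounded : exists2 M : R, 0 <= M &
  forall x w, `|recourse T W q d Y Z x w| <= M.
Proof.
have [k [y [g phiE]]] := phi_code W q d finY.
exists (\sum_b `|fine (g b)|) => [|x w]; first exact: sumr_ge0.
rewrite /recourse phiE; set b := finfun _.
by rewrite (bigD1 b)//= lerDl sumr_ge0.
Qed.

(** The code of T x + z changes to that of T x' + z only when z lies in one of
    the finitely many slabs, indexed by an integer point and a row of W, between
    the thresholds for x and for x'. *)
Lemma recourse_eq_outside : has_bounded_density (distribution P Z) ->
  compact (msupport (distribution P Z)) ->
  exists2 S : R, 0 <= S & forall x x', exists2 A, measurable A /\
    (forall w, ~ A (Z w) ->
       recourse T W q d Y Z x w = recourse T W q d Y Z x' w) &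
    (distribution P Z A <= (S * `|x - x'|)%:E)%E.
Proof.
move=> dens cpt.
have [k [y [g phiE]]] := phi_code W q d finY.
have [K K0 slabK] := bounded_density_slab dens cpt.
exists (\sum_(ij : 'I_k * 'I_s) K * \sum_(l < n) `|T ij.2 l|).
  by apply: sumr_ge0 => ij _; rewrite mulr_ge0// sumr_ge0.
move=> x x'.
pose t j := (T *m x) j ord0; pose t' j := (T *m x') j ord0.
pose b (ij : 'I_k * 'I_s) := (W *m y ij.1) ij.2 ord0.
pose lo ij := b ij - Num.max (t ij.2) (t' ij.2).
pose hi ij := b ij - Num.min (t ij.2) (t' ij.2).
pose A ij := [set z : 'cV[R]_s | lo ij <= z ij.2 ord0 < hi ij].
have mA ij : measurable (A ij) by exact: measurable_slab.
exists (\big[setU/set0]_ij A ij).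
  split=> [|w nA]; first exact: bigsetU_measurable.
  rewrite /recourse !phiE; congr (fine (g _)).
  apply/ffunP => i; rewrite !ffunE; apply: eq_forallb => j.
  apply/eqP/negPn/negP => ne; apply: nA; rewrite -bigcup_seq.
  exists (i, j); first by rewrite /= mem_index_enum.
  apply: threshold_change; move: ne.
  by rewrite [(T *m x + _) _ _]mxE [(T *m x' + _) _ _]mxE.
apply: le_trans (measure_bigsetU_le _ _ mA) _.
rewrite mulr_suml -sumEFin; apply: lee_sum => ij _.
apply: le_trans (slabK _ _ _ _) _.
  by rewrite /lo /hi lerD2l lerN2 ge_min le_max lexx.
rewrite lee_fin -mulrA ler_wpM2l//.
have -> : hi ij - lo ij = `|(T *m (x - x')) ij.2 ord0|.
  have -> : (T *m (x - x')) ij.2 ord0 = t ij.2 - t' ij.2.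
    by rewrite mulmxBr [LHS]mxE [X in _ + X]mxE.
  rewrite /hi /lo.
  by case: leP => tt'; [rewrite ler0_norm|rewrite gtr0_norm]; lra.
exact: ler_coord_mulmx.
Qed.

(** With M a bound for the recourse and A the exceptional event, of probability
    at most S |x - x'|, the p-th power of the distance is at most
    (2 M)^p S |x - x'|. *)
Lemma recourse_Lp_dist_hoelder (p : R) (p1 : (1 <= p%:E)%E) :
  has_bounded_density (distribution P Z) ->
  compact (msupport (distribution P Z)) ->
  exists2 L : R, 0 <= L & forall x x',
    Lp_dist (recourse_Lp T W q d Z p1 finY x)
      (recourse_Lp T W q d Z p1 finY x') <= L * `|x - x'| `^ p^-1.
Proof.
move=> dens cpt.
have p0 : 0 < p by rewrite (lt_le_trans ltr01).
have [M M0 recM] := recourse_bounded.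
have [S S0 recS] := recourse_eq_outside dens cpt.
exists (((2 * M) `^ p * S) `^ p^-1) => [|x x']; first exact: powR_ge0.
rewrite -powRM ?mulr_ge0 ?powR_ge0//.
set X := recourse_Lp _ _ _ _ _ _ _ x; set X' := recourse_Lp _ _ _ _ _ _ _ x'.
have D0 : 0 <= Lp_dist X X' by apply/fine_ge0/Lnorm_ge0.
have -> : Lp_dist X X' = (Lp_dist X X' `^ p) `^ p^-1.
  by rewrite -powRrM mulfV ?powRr1 ?gt_eqF.
have B0 : 0 <= (2 * M) `^ p * S * `|x - x'|.
  by rewrite !mulr_ge0 ?powR_ge0.
rewrite ge0_ler_powR ?invr_ge0 ?(ltW p0)// ?nnegrE ?powR_ge0//.
rewrite -lee_fin Lp_seminorm_powR.
have [A [mA recA] PA] := recS x x'.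
have mZA : measurable (Z @^-1` A).
  by rewrite -[X in measurable X]setTI; exact: measurable_funPT.
apply: (@le_trans _ _ (\int[P]_w ((2 * M) `^ p * \1_(Z @^-1` A) w)%:E)%E).
  apply: ge0_le_integral => //.
  - apply/measurable_EFinP.
    apply: (measurableT_comp (measurable_powR p)) => //.
    exact: measurableT_comp.
  - apply/measurable_EFinP; apply: measurable_funM => //.
  - move=> w _; rewrite lee_fin.
    have -> : (X - X') w =
      recourse T W q d Y Z x w - recourse T W q d Y Z x' w by [].
    case: (pselect (A (Z w))) => [Aw|nAw].
      rewrite indicE mem_set// mulr1 ge0_ler_powR ?nnegrE ?mulr_ge0 ?(ltW p0)//.
      apply: le_trans (ler_normB _ _) _; have := recM x w; have := recM x' w.
      lra.
    by rewrite recA// subrr normr0 powR0 ?gt_eqF// mulr_ge0// powR_ge0.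
under eq_integral do rewrite EFinM.
rewrite ge0_integralZl_EFin ?powR_ge0//; last first.
  by apply/measurable_EFinP; exact: measurable_indic.
rewrite integral_indic// setIT -mulrA [leRHS]EFinM.
by apply: lee_wpmul2l => //; rewrite lee_fin powR_ge0.
Qed.

End recourse_hoelder.

(** * Composition of a Hoelder continuous map with a risk functional *)

Section hoelder_composition.
Context (R : realType) (n : nat) disp (Omega : measurableType disp).
Context (P : probability Omega R) (p : R) (p1 : (1 <= p%:E)%E).
Variable F : 'cV[R]_n -> LfunType P p1.
Variable a : R.
Hypothesis a0 : 0 < a.
Hypothesis F_hoelder : exists2 L : R, 0 <= L &
  forall x x', Lp_dist (F x) (F x') <= L * `|x - x'| `^ a.

Lemma risk_lipschitz_hoelder (rho : LfunType P p1 -> R) A :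
  risk_lipschitz rho -> hoelder_on A a (rho \o F).
Proof.
move: F_hoelder => [L L0 FL] [K K0 rhoK]; exists (K * L); first exact: mulr_ge0.
move=> x x' _ _; rewrite -mulrA; apply: le_trans (rhoK _ _) _.
exact: ler_wpM2l.
Qed.

(** F maps a small ball around x0 into the ball around F x0 where rho is
    Lipschitz. *)
Lemma risk_locally_bounded_above_hoelder (rho : LfunType P p1 -> R) A :
  risk_convex rho ->
  (forall X0, exists2 del : R, 0 < del &
    exists C, forall X, Lp_dist X X0 < del -> rho X <= C) ->
  locally_hoelder_on A a (rho \o F).
Proof.
move: F_hoelder => [L L0 FL] cvx bdd x0 _.
have [del del0 [C rhoC]] := bdd (F x0).
have [K K0 rhoK] := convex_bounded_above_lipschitz
  (@Lp_seminormD _ _ _ P p p1) (@Lp_seminormZ _ _ _ P p p1) del0 cvx rhoC.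
have L1 : 0 < L + 1 by rewrite ltr_wpDl.
(* L c < del / 2, so the radius c^(1/a) will do *)
pose c := del / 2 / (L + 1).
have c0 : 0 < c by rewrite !divr_gt0.
have F_near x : `|x0 - x| < c `^ a^-1 -> Lp_dist (F x) (F x0) < del / 2.
  move=> xr; apply: le_lt_trans (FL _ _) _; rewrite distrC.
  apply: (@le_lt_trans _ _ (L * c)).
    apply: ler_wpM2l => //.
    have -> : c = (c `^ a^-1) `^ a.
      by rewrite -powRrM mulVf ?powRr1 ?gt_eqF ?ltW.
    by rewrite ge0_ler_powR ?(ltW a0) ?nnegrE ?powR_ge0// ltW.
  by rewrite /c mulrCA gtr_pMr ?divr_gt0// ltr_pdivrMr// mul1r ltrDl.
exists (ball x0 (c `^ a^-1)); first by apply: nbhsx_ballx; exact: powR_gt0.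
exists (K * L); first exact: mulr_ge0.
move=> x x' [+ _] [+ _]; rewrite -ball_normE /= => /F_near xd /F_near x'd.
rewrite -mulrA; apply: le_trans (rhoK _ _ xd x'd) _.
by apply: ler_wpM2l => //; exact: FL.
Qed.

End hoelder_composition.

Theorem proposition4p1 (R : realType) (n m s : nat)
  (T : 'M[R]_(s, n)) (W : 'M[R]_(s, m)) (q d : 'cV[R]_m) (Y : set 'cV[R]_m)
  (disp : measure_display) (Omega : measurableType disp)
  (P : probability Omega R) (Z : {RV P >-> 'cV[R]_s})
  (p : R) (p1 : (1 <= p%:E)%E)
  (Y0 : integer_points Y !=set0)
  (finY : finite_set (integer_points Y))
  (densZ : has_bounded_density (distribution P Z))
  (cptZ : compact (msupport (distribution P Z)))
  (rho : LfunType P p1 -> R) :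
  let FZ := F_Z T W q d Y Z in
  let Q := fun x => rho (recourse_Lp T W q d Z p1 finY x) in
  [/\ risk_convex rho -> risk_continuous rho -> locally_hoelder_on FZ p^-1 Q,
      risk_convex rho -> risk_nondecreasing rho ->
        locally_hoelder_on FZ p^-1 Q,
      convex_risk_measure rho -> locally_hoelder_on FZ p^-1 Q,
      risk_lipschitz rho -> hoelder_on FZ p^-1 Q &
      coherent_risk_measure rho -> hoelder_on FZ p^-1 Q].
Proof.
move=> FZ Q.
have pV0 : 0 < p^-1 by rewrite invr_gt0 (lt_le_trans ltr01).
have FL := recourse_Lp_dist_hoelder T W q d finY p1 densZ cptZ.
have lip : risk_lipschitz rho -> hoelder_on FZ p^-1 Q.
  exact: (risk_lipschitz_hoelder FL).
have mono : risk_convex rho -> risk_nondecreasing rho ->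
    locally_hoelder_on FZ p^-1 Q.
  move=> cvx nd; apply: (risk_locally_bounded_above_hoelder pV0 FL) => // X0.
  exact: nondecreasing_locally_bounded_above.
split=> //; last by move=> /coherent_risk_lipschitz; exact: lip.
- move=> cvx cont; apply: (risk_locally_bounded_above_hoelder pV0 FL) => // X0.
  have [del del0 near1] := cont X0 1 ltr01.
  exists del => //; exists (rho X0 + 1) => X; rewrite Lp_distC => /near1.
  by rewrite ltr_distl => /andP[]; lra.
- by case=> cvx nd _; exact: mono.
Qed.
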